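(* Let $\mathcal F(x_1,x_2,s)=A(x_1,x_2)s^2+B(x_1,x_2)s+C(x_1,x_2)$ be a polynomial of degree two in each of the three variables $x_1,x_2,s$ which is discriminantly separable, i.e. there are one-variable polynomials $P,J$ with $$B^2-4AC=4P(x_1)P(x_2),\quad \mathcal D_{x_1}(\mathcal F)(s,x_2)=4P(x_2)J(s),\quad \mathcal D_{x_2}(\mathcal F)(s,x_1)=4P(x_1)J(s).$$ Suppose that a given system of differential equations in the variables $x_1,x_2,e_1,e_2,r,\gamma_3$ reduces, after some transformations, to $$2\dot x_1=-if_1,\quad \dot e_1=-me_1,\qquad 2\dot x_2=if_2,\quad \dot e_2=me_2,$$ where $m$ is some function of the system's variables and $$f_1^2=P(x_1)+e_1A(x_1,x_2),\qquad f_2^2=P(x_2)+e_2A(x_1,x_2),$$ and suppose additionally that the first integrals and invariant relations of the system reduce to the relation $$P(x_2)e_1+P(x_1)e_2=C(x_1,x_2)-e_1e_2A(x_1,x_2).$$ Then the system is linearized on the Jacobian of the curve $$y^2=J(z)(z-k)(z+k),$$ where $k$ is a constant such that $e_1e_2=k^2$.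
   Context: $\mathcal D_{u}(\mathcal F)$ denotes the discriminant of $\mathcal F$ regarded as a quadratic polynomial in the variable $u$, as a function of the other two variables. All variables are complex; the dot is $d/dt$. The equations for $\dot r$ and $\dot\gamma_3$ are not specified. The product $e_1e_2$ is constant along solutions by the equations for $\dot e_1,\dot e_2$; $k$ is a constant with $e_1e_2=k^2$. ''Linearized on the Jacobian of the curve $y^2=\Phi(z)$'', with $\Phi(z)=J(z)(z-k)(z+k)$ (of degree at most six; the curve has genus two when $\Phi$ has degree five or six with distinct roots), means: if $s_1,s_2$ denote the two roots of $\mathcal F(x_1,x_2,s)=0$ in $s$, then along the solutions of the system (where the quantities are defined) $$\frac{ds_1}{\sqrt{\Phi(s_1)}}+\frac{ds_2}{\sqrt{\Phi(s_2)}}=c_0\,dt,\qquad \frac{s_1\,ds_1}{\sqrt{\Phi(s_1)}}+\frac{s_2\,ds_2}{\sqrt{\Phi(s_2)}}=c_1\,dt$$ with constants $c_0,c_1$ not both zero, i.e. the image of the pair of points over $s_1,s_2$ under the Abel map moves linearly in $t$. All square roots (including $f_1,f_2$, which are given only through their squares) are understood with suitable choices of branches.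
   Formalization: Added: J is not the square of a polynomial; the claim fails for F=(s-x1x2)(s-2x1x2), P=-x^2/2, J=-s^2/2. The suitable branches of f1, f2 are made explicit: f1f2=eps*B/2 with a sign eps=±1 depending only on F, P, J. *)

(* Defs.v *)
From HB Require Import structures.
From mathcomp Require Import all_boot all_order all_algebra.
From mathcomp Require Import all_classical all_reals all_analysis.
From mathcomp Require Import complex.

Set Implicit Arguments.
Unset Strict Implicit.
Unset Printing Implicit Defensive.

Import Order.TTheory GRing.Theory Num.Theory numFieldNormedType.Exports.
Local Open Scope ring_scope.
Local Open Scope classical_set_scope.

(* Packing R[i] as a numClosedFieldType lets the generic topology and normed
   module structure of numeric fields be inferred on it (R[i] itself carries no
   such structure in the library); derivatives of functions Cplx R -> Cplx R
   are therefore complex derivatives. *)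
Definition Cplx (R : realType) : numClosedFieldType := R[i]%C.

Section Triquadratic.
Variable R : realType.
Local Notation C := (Cplx R).

(* A polynomial of degree at most two in each of x1, x2, s is given by its
   coefficients: [a i j l] is the coefficient of x1^i x2^j s^l.  The values of
   [a] at indices larger than 2 are never used. *)
Implicit Type a : nat -> nat -> nat -> C.

Definition tri_eval a (x1 x2 s : C) : C :=
  \sum_(i < 3) \sum_(j < 3) \sum_(l < 3) a i j l * x1 ^+ i * x2 ^+ j * s ^+ l.

Definition coef_s a (l : nat) (x1 x2 : C) : C :=
  \sum_(i < 3) \sum_(j < 3) a i j l * x1 ^+ i * x2 ^+ j.

Definition coef_x1 a (i : nat) (s x2 : C) : C :=
  \sum_(j < 3) \sum_(l < 3) a i j l * x2 ^+ j * s ^+ l.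

Definition coef_x2 a (j : nat) (s x1 : C) : C :=
  \sum_(i < 3) \sum_(l < 3) a i j l * x1 ^+ i * s ^+ l.

(* Some coefficient of each of x1^2, x2^2 and s^2 is nonzero. *)
Definition degree_two_in_each a : Prop :=
  [/\ exists j l : 'I_3, a 2%N j l != 0,
      exists i l : 'I_3, a i 2%N l != 0 &
      exists i j : 'I_3, a i j 2%N != 0].

Definition discr (q : nat -> C) : C := q 1%N ^+ 2 - 4 * q 2%N * q 0%N.

(* Equality of polynomial functions is equality of polynomials over C. *)
Definition discriminantly_separable a (P J : {poly C}) : Prop :=
  [/\ forall x1 x2, discr (fun l => coef_s a l x1 x2) = 4 * P.[x1] * P.[x2],
      forall s x2, discr (fun i => coef_x1 a i s x2) = 4 * P.[x2] * J.[s] &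
      forall s x1, discr (fun j => coef_x2 a j s x1) = 4 * P.[x1] * J.[s]].

Definition Phi (J : {poly C}) (k : C) : {poly C} :=
  J * ('X - k%:P) * ('X + k%:P).

End Triquadratic.

Section System.
Variable R : realType.
Local Notation C := (Cplx R).

Definition scaled_deriv (c : C) (x : C -> C) (t v : C) : Prop :=
  derivable x t 1 /\ c * derive1 x t = v.

(* The reduced system on U, together with its first integrals.  No equation is
   imposed on r and gamma3, which may only enter through m.  The branches f1,
   f2 of the square roots are functions of time along the solution. *)
Record reduced_solution (a : nat -> nat -> nat -> C) (P : {poly C})
    (m : C -> C -> C -> C -> C -> C -> C) (U : set C)
    (x1 x2 e1 e2 r gamma3 f1 f2 : C -> C) : Prop := ReducedSolution {
  rs_x1 : forall t, U t -> scaled_deriv 2 x1 t (- 'i * f1 t);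
  rs_x2 : forall t, U t -> scaled_deriv 2 x2 t ('i * f2 t);
  rs_e1 : forall t, U t -> scaled_deriv 1 e1 t
    (- m (x1 t) (x2 t) (e1 t) (e2 t) (r t) (gamma3 t) * e1 t);
  rs_e2 : forall t, U t -> scaled_deriv 1 e2 t
    (m (x1 t) (x2 t) (e1 t) (e2 t) (r t) (gamma3 t) * e2 t);
  rs_f1_cont : {in U, continuous f1};
  rs_f2_cont : {in U, continuous f2};
  rs_f1 : forall t, U t ->
    f1 t ^+ 2 = P.[x1 t] + e1 t * coef_s a 2 (x1 t) (x2 t);
  rs_f2 : forall t, U t ->
    f2 t ^+ 2 = P.[x2 t] + e2 t * coef_s a 2 (x1 t) (x2 t);
  rs_relation : forall t, U t ->
    P.[x2 t] * e1 t + P.[x1 t] * e2 t =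
    coef_s a 0 (x1 t) (x2 t) - e1 t * e2 t * coef_s a 2 (x1 t) (x2 t)
}.

(* s1, s2 are continuous labellings of the two roots of F(x1, x2, s) = 0, and
   the differentials ds_i / sqrt (Phi s_i) are defined. *)
Record separation_roots (a : nat -> nat -> nat -> C) (Ph : {poly C})
    (U : set C) (x1 x2 s1 s2 : C -> C) : Prop := SeparationRoots {
  sr_s1_cont : {in U, continuous s1};
  sr_s2_cont : {in U, continuous s2};
  sr_lead : forall t, U t -> coef_s a 2 (x1 t) (x2 t) != 0;
  sr_root1 : forall t, U t -> tri_eval a (x1 t) (x2 t) (s1 t) = 0;
  sr_root2 : forall t, U t -> tri_eval a (x1 t) (x2 t) (s2 t) = 0;
  sr_neq : forall t, U t -> s1 t != s2 t;
  sr_Phi1 : forall t, U t -> Ph.[s1 t] != 0;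
  sr_Phi2 : forall t, U t -> Ph.[s2 t] != 0
}.

(* y1, y2 are continuous branches of sqrt (Phi s1), sqrt (Phi s2). *)
Definition linearized_on_jacobian (Ph : {poly C}) (U : set C)
    (s1 s2 : C -> C) (c0 c1 : C) : Prop :=
  exists y1 y2 : C -> C,
    [/\ {in U, continuous y1}, {in U, continuous y2} &
     forall t, U t ->
      [/\ derivable s1 t 1 /\ derivable s2 t 1,
          y1 t ^+ 2 = Ph.[s1 t] /\ y2 t ^+ 2 = Ph.[s2 t],
          derive1 s1 t / y1 t + derive1 s2 t / y2 t = c0 &
          s1 t * derive1 s1 t / y1 t + s2 t * derive1 s2 t / y2 t = c1]].

End System.

(* Main.v *)
(* On the surface F = 0 the partial derivatives satisfy F_x1^2 = 4 P(x2) J(s),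
   F_x2^2 = 4 P(x1) J(s) and F_s^2 = 4 P(x1) P(x2), hence
   F_x1 F_x2 = delta * 2 J F_s with delta = 1 or -1.  As J is not a square, F is
   irreducible in x1 over C(x2, s), so delta is the same on the whole surface;
   eps := delta.  Differentiating F(x1, x2, s_i) = 0 along the flow then gives
   s_1' = i y_1 / (s_1 - s_2) and s_2' = i y_2 / (s_2 - s_1), where
   y_i = (F_x1(s_i) f_1 - F_x2(s_i) f_2) / (2 A), and the invariant relation
   turns y_i^2 into J(s_i) (s_i^2 - k^2).  So c0 = 0 and c1 = i. *)
Require Import Defs.
From HB Require Import structures.
From mathcomp Require Import all_boot all_order all_algebra.
From mathcomp Require Import all_classical all_reals all_analysis.
From mathcomp Require Import complex ring.

Set Implicit Arguments.
Unset Strict Implicit.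
Unset Printing Implicit Defensive.

Import Order.TTheory GRing.Theory Num.Theory numFieldNormedType.Exports.
Local Open Scope ring_scope.
Local Open Scope classical_set_scope.

(** * Polynomials over integral domains: nonroots and specialization *)

Lemma poly_nat_nonroot (A : idomainType) (p : {poly A}) :
  (forall n : nat, n.+1%:R != 0 :> A) -> p != 0 -> exists n : nat, p.[n%:R] != 0.
Proof.
move=> ch0 p0; apply/not_existsP => h.
have ninj : injective (fun n : nat => n%:R : A).
  move=> m n /eqP; wlog lt : m n / (m < n)%N.
    by move=> H; case: (ltngtP m n) => // l e; [apply: H|apply/esym/H; rewrite // eq_sym].
  rewrite eq_sym -subr_eq0 -natrB ?(ltnW lt)//.
  by rewrite -(subnSK lt) (negPf (ch0 _)).
(* Naturals are distinct in characteristic 0, so [size p] of them are one root more than the degree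
   of [p] allows. *)
have := @max_poly_roots A p [seq i%:R | i <- iota 0 (size p)] p0.
rewrite size_map size_iota ltnn => H; suff: false by []; apply: H; last first.
  by rewrite map_inj_uniq ?iota_uniq.
apply/allP => _ /mapP[i _ ->]; apply/rootP/eqP.
by have /negP := h i; rewrite negbK.
Qed.

Lemma horner_evalXC (A : comNzRingType) (h : A) : horner_eval h ('X - h%:P) = 0.
Proof. by rewrite /horner_eval hornerXsubC subrr. Qed.

(* A factor X - h of the multiplier c kills Q at X = h, because F survives
   there; it can therefore be cancelled, until c no longer vanishes at h. *)
Lemma specialize_multiple (A : idomainType) (h : A) (c : {poly A})
    (F W Q : {poly {poly A}}) :
  c != 0 -> c *: W = Q * F -> map_poly (horner_eval h) F != 0 ->
  exists2 c' : A, c' != 0 &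
  exists Q' : {poly A},
    c' *: map_poly (horner_eval h) W = Q' * map_poly (horner_eval h) F.
Proof.
move=> + + F0; have [n] := ubnP (size c); elim: n => // n IH in c Q * => cn c0 e.
have [rc|rc] := boolP (root c h); last first.
  exists c.[h] => //; exists (map_poly (horner_eval h) Q).
  by rewrite -rmorphM -e /= map_polyZ.
have /factor_theorem[c1 ec] := rc.
have Xh0 : ('X - h%:P : {poly A}) != 0 by rewrite polyXsubC_eq0.
have c10 : c1 != 0 by apply: contraNneq c0 => c10; rewrite ec c10 mul0r.
have Q0 : map_poly (horner_eval h) Q = 0.
  apply/eqP; rewrite -[_ == 0]orbF -(negPf F0) -mulf_eq0 -rmorphM -e.
  by rewrite /= map_polyZ ec rmorphM /= horner_evalXC mulr0 scale0r.
have [Q1 eQ] : exists Q1, Q = ('X - h%:P)%:P * Q1.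
  have /choice[g hg] : forall i, exists r, Q`_i = r * ('X - h%:P).
    move=> i; apply/factor_theorem/rootP.
    by rewrite -[LHS]/(horner_eval h Q`_i) -coef_map Q0 coef0.
  exists (\poly_(i < size Q) g i); apply/polyP => i.
  rewrite coefCM coef_poly; case: ltnP => [_|/leq_sizeP/(_ i (leqnn i))->].
    by rewrite hg mulrC.
  by rewrite mulr0.
apply: (IH c1 Q1) => //.
  by move: cn; rewrite ec size_Mmonic ?monicXsubC // size_XsubC addn2.
have X0 : ('X - h%:P)%:P != 0 :> {poly {poly A}} by rewrite polyC_eq0.
apply: (mulfI X0); rewrite mulrA -eQ -e ec -!mul_polyC !polyCM; ring.
Qed.

(** Over a domain [%|] rests on pseudo-division: it is divisibility over the fraction field, with
    the denominators collected in [d]. *)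
Lemma dvdp_idomainP (A : idomainType) (p q : {poly A}) : q %| p ->
  exists2 d : A, d != 0 & exists Q : {poly A}, d *: p = Q * q.
Proof. by move=> /Pdiv.WeakIdomain.dvdpP[[d Q] /= d0 e]; exists d => //; exists Q. Qed.

(** * Irreducible quadratics and the uniform sign *)

Section SignLemma.
Variable K : numClosedFieldType.
Implicit Types (P J : {poly K}) (c g : {poly {poly K}}).

Lemma natP_neq0 n : n.+1%:R != 0 :> {poly K}.
Proof. by rewrite -polyC_natr polyC_eq0 pnatr_eq0. Qed.

Lemma natPP_neq0 n : n.+1%:R != 0 :> {poly {poly K}}.
Proof. by rewrite -polyC_natr polyC_eq0 natP_neq0. Qed.

(** As [f ^+ 2] divides [g ^+ 2], [f] divides [g]; the quotient squares to [z *: J], and [sqrtC z]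
    absorbs the constant. *)
Lemma square_factor_poly J (f g : {poly K}) (z : K) :
  f != 0 -> z != 0 -> f ^+ 2 * (z *: J) = g ^+ 2 -> exists j, J = j ^+ 2.
Proof.
move=> f0 z0 e; have : f %| g by rewrite -(@dvdp_pexp2r _ _ _ 2) // -e dvdp_mulr.
move=> /dvdpP[h eg]; have eJ : z *: J = h ^+ 2.
  by apply: (mulfI (expf_neq0 2 f0)); rewrite e eg; ring.
exists ((sqrtC z)^-1 *: h).
by rewrite exprZn -eJ scalerA exprVn sqrtCK mulVf // scale1r.
Qed.

(** Specializing the outer variable at a natural number where neither [c] nor [P] vanishes leaves
    the one-variable case. Read contrapositively: if [J] is not a square and [P] is nonzero, then 4
    P(x2) J(s) is not a square in K(x2, s). *)
Lemma square_factor_bipoly P J c g :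
  c != 0 -> P != 0 ->
  c ^+ 2 * (4 * map_poly polyC P * J%:P) = g ^+ 2 -> exists j, J = j ^+ 2.
Proof.
move=> c0 P0 e.
have mP0 : map_poly polyC P != 0 by rewrite map_poly_eq0_id0 ?polyC_eq0 ?lead_coef_eq0.
have [n] := poly_nat_nonroot natP_neq0 (mulf_neq0 c0 mP0).
rewrite -polyC_natr; move: (n%:R : K) => z.
rewrite hornerM mulf_eq0 negb_or horner_map polyC_eq0 => /andP[cz Pz].
apply: (@square_factor_poly _ c.[z%:P] g.[z%:P] (4 * P.[z])) => //.
  by rewrite mulf_neq0 ?pnatr_eq0.
rewrite -!horner_exp -e !(hornerM, horner_exp, hornerC) horner_map.
by rewrite -(polyC_natr _ 4) hornerC -mul_polyC polyCM -expr2 polyC_natr.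
Qed.

Definition quadr (A : nzRingType) (q b c : A) : {poly A} :=
  q%:P * 'X ^+ 2 + b%:P * 'X + c%:P.

Lemma size_quadr (A : idomainType) (q b c : A) : q != 0 -> size (quadr q b c) = 3.
Proof.
move=> q0; rewrite /quadr -addrA size_polyDl.
  by rewrite size_Cmul // size_polyXn.
rewrite size_Cmul // size_polyXn ltnS.
apply: leq_trans (size_polyD _ _) _; rewrite geq_max.
rewrite (leq_trans (size_polyC_leq1 _)) // andbT.
apply: leq_trans (size_polyMleq _ _) _.
by rewrite size_polyX addn2 /= ltnS size_polyC_leq1.
Qed.

Lemma quadr_deriv (A : comNzRingType) (q b c : A) :
  deriv (quadr q b c) = (2 * q)%:P * 'X + b%:P.
Proof. rewrite /quadr !derivD !derivM !derivC !derivX polyCM polyCD polyC1; ring. Qed.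

Lemma quadr_deriv_sqr (A : comNzRingType) (q b c : A) :
  ((2 * q)%:P * 'X + b%:P) ^+ 2 =
  (b ^+ 2 - 4 * q * c)%:P + 4 * q%:P * quadr q b c.
Proof.
rewrite /quadr polyCB polyC_exp !polyCM !polyC_natr.
move: q%:P b%:P c%:P 'X => Q B D X; ring.
Qed.

(** Modulo [F], both (U V)^2 and (2 j W)^2 reduce to 16 p1 p2 j^2; the right-hand side makes the
    cofactor explicit. *)
Lemma sign_product (A : comNzRingType) (U V W F p1 p2 j q v w : A) :
  U ^+ 2 = 4 * p2 * j + 4 * q * F -> V ^+ 2 = 4 * p1 * j + 4 * v * F ->
  W ^+ 2 = 4 * p1 * p2 + 4 * w * F ->
  (U * V - 2 * j * W) * (U * V + 2 * j * W) =
  (4 * q * V ^+ 2 + 16 * p2 * j * v - 16 * j ^+ 2 * w) * F.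
Proof.
move=> hU hV hW.
transitivity (U ^+ 2 * V ^+ 2 - 4 * j ^+ 2 * W ^+ 2); first by ring.
by rewrite hU hV hW; ring.
Qed.

(** The gcd of the quadratic with [V] has size 1, 2 or 3. Size 1 means coprime, so Gauss applies;
    size 3 means that the quadratic divides [V]; size 2 would split it into linear factors, making
    its discriminant a square up to [d ^+ 2]. *)
Lemma quadr_prime (A : idomainType) (q b c : A) (V W : {poly A}) :
  q != 0 -> (forall d g : A, d != 0 -> d ^+ 2 * (b ^+ 2 - 4 * q * c) != g ^+ 2) ->
  quadr q b c %| V * W -> quadr q b c %| V \/ quadr q b c %| W.
Proof.
move=> q0 ns dv; set F := quadr q b c in dv *.
have sF : size F = 3 by apply: size_quadr.
have F0 : F != 0 by rewrite -size_poly_eq0 sF.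
have gF := dvdp_gcdl F V; have gV := dvdp_gcdr F V.
have g0 : gcdp F V != 0 by rewrite gcdp_eq0 negb_and F0.
have [|] := boolP (coprimep F V); first by move=> /Gauss_dvdpr e; right; rewrite -e.
rewrite coprimep_def => g1.
have := dvdp_leq F0 gF; rewrite sF leq_eqVlt => /orP[/eqP g3|g3].
  left; move: (dvdp_size_eqp gF); rewrite sF g3 eqxx => /esym e.
  by rewrite -(eqp_dvdl _ e).
exfalso; have g2 : size (gcdp F V) = 2.
  by move: g0 g1 g3; rewrite -size_poly_gt0; case: (size _) => [|[|[|]]].
have [d d0 [Q e]] := dvdp_idomainP gF.
have Q0 : Q != 0.
  apply: contraNneq F0 => Q0; move: e; rewrite Q0 mul0r => /eqP.
  by rewrite -mul_polyC mulf_eq0 polyC_eq0 (negPf d0).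
have sQ : size Q = 2.
  move: (congr1 (size \o polyseq) e) => /=.
  by rewrite size_scale // sF size_mul // g2 addn2 /= => -[].
move: (gcdp F V) g2 e => G sG e.
have G2 : G`_2 = 0 by apply/leq_sizeP: (leqnn 2); rewrite sG.
have Q2 : Q`_2 = 0 by apply/leq_sizeP: (leqnn 2); rewrite sQ.
have E i : d * F`_i = \sum_(j < i.+1) Q`_j * G`_(i - j) by rewrite -coefZ e coefM.
have e2 : d * q = Q`_1 * G`_1.
  move: (E 2%N); rewrite !big_ord_recr big_ord0 /= G2 Q2 mulr0 mul0r addr0 !add0r.
  by rewrite /F /quadr !(coefD, coefCM, coefXn, coefX, coefC) /= mulr0 mulr1 !addr0.
have e1 : d * b = Q`_0 * G`_1 + Q`_1 * G`_0.
  move: (E 1%N); rewrite !big_ord_recr big_ord0 /= add0r.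
  by rewrite /F /quadr !(coefD, coefCM, coefXn, coefX, coefC) /= mulr0 mulr1 !addr0 add0r.
have e0 : d * c = Q`_0 * G`_0.
  move: (E 0%N); rewrite big_ord_recr big_ord0 /= add0r.
  by rewrite /F /quadr !(coefD, coefCM, coefXn, coefX, coefC) /= !mulr0 !add0r.
(* The discriminant of a product of two linear factors is the square of the determinant of their
   coefficients. *)
have := ns d (Q`_0 * G`_1 - Q`_1 * G`_0) d0.
move=> /eqP; apply.
rewrite (_ : _ * _ = (d * b) ^+ 2 - 4 * (d * q) * (d * c)); last by ring.
by rewrite e0 e1 e2; ring.
Qed.

(** The outermost variable stands for x1, the middle one for x2, the innermost one for s. With x1
    outermost, [%|] is divisibility in x1 over K(x2, s), the setting in which F is irreducible. *)
Definition ev3 (x1 x2 s : K) (p : {poly {poly {poly K}}}) : K :=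
  horner_eval s (horner_eval x2%:P (horner_eval x1%:P%:P p)).

Lemma ev3D x1 x2 s p q : ev3 x1 x2 s (p + q) = ev3 x1 x2 s p + ev3 x1 x2 s q.
Proof. by rewrite /ev3 !rmorphD. Qed.

Lemma ev3N x1 x2 s p : ev3 x1 x2 s (- p) = - ev3 x1 x2 s p.
Proof. by rewrite /ev3 !rmorphN. Qed.

Lemma ev3M x1 x2 s p q : ev3 x1 x2 s (p * q) = ev3 x1 x2 s p * ev3 x1 x2 s q.
Proof. by rewrite /ev3 !rmorphM. Qed.

Lemma ev3X x1 x2 s p n : ev3 x1 x2 s (p ^+ n) = ev3 x1 x2 s p ^+ n.
Proof. by rewrite /ev3 !rmorphXn. Qed.

Lemma ev3_nat x1 x2 s n : ev3 x1 x2 s n%:R = n%:R.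
Proof. by rewrite /ev3 !rmorph_nat. Qed.

Lemma ev3_sum x1 x2 s n (f : 'I_n -> {poly {poly {poly K}}}) :
  ev3 x1 x2 s (\sum_(i < n) f i) = \sum_(i < n) ev3 x1 x2 s (f i).
Proof. by rewrite /ev3 !rmorph_sum. Qed.

Lemma ev3C x1 x2 s (z : K) : ev3 x1 x2 s z%:P%:P%:P = z.
Proof. by rewrite /ev3 /horner_eval !hornerC. Qed.

Lemma ev3x x1 x2 s : ev3 x1 x2 s 'X = x1.
Proof. by rewrite /ev3 /horner_eval hornerX !hornerC. Qed.

Lemma ev3y x1 x2 s : ev3 x1 x2 s 'X%:P = x2.
Proof. by rewrite /ev3 /horner_eval hornerC hornerX hornerC. Qed.

Lemma ev3z x1 x2 s : ev3 x1 x2 s 'X%:P%:P = s.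
Proof. by rewrite /ev3 /horner_eval !hornerC hornerX. Qed.

Definition inx P : {poly {poly {poly K}}} := map_poly (fun z => z%:P%:P) P.
Definition iny P : {poly {poly {poly K}}} := (map_poly polyC P)%:P.

Lemma ev3_inx x1 x2 s P : ev3 x1 x2 s (inx P) = P.[x1].
Proof.
rewrite /ev3 /inx /horner_eval -[map_poly _ P]/(map_poly (polyC \o polyC) P).
by rewrite (horner_map (polyC \o polyC)) /= !hornerC.
Qed.

Lemma ev3_iny x1 x2 s P : ev3 x1 x2 s (iny P) = P.[x2].
Proof. by rewrite /ev3 /iny /horner_eval hornerC horner_map hornerC. Qed.

Lemma ev3_inz x1 x2 s P : ev3 x1 x2 s P%:P%:P = P.[s].
Proof. by rewrite /ev3 /horner_eval !hornerC. Qed.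

Lemma ev3_discr x1 x2 s (q b c : {poly {poly {poly K}}}) :
  ev3 x1 x2 s (b ^+ 2 - 4 * q * c) =
  ev3 x1 x2 s b ^+ 2 - 4 * ev3 x1 x2 s q * ev3 x1 x2 s c.
Proof. by rewrite ev3D ev3N ev3X !ev3M ev3_nat. Qed.

Lemma ev3_4M x1 x2 s (p q : {poly {poly {poly K}}}) :
  ev3 x1 x2 s (4 * p * q) = 4 * ev3 x1 x2 s p * ev3 x1 x2 s q.
Proof. by rewrite !ev3M ev3_nat. Qed.

Lemma ev3_2M x1 x2 s (p q : {poly {poly {poly K}}}) :
  ev3 x1 x2 s (2 * p * q) = 2 * ev3 x1 x2 s p * ev3 x1 x2 s q.
Proof. by rewrite !ev3M ev3_nat. Qed.

Lemma ev3_lin x1 x2 s (p q r : {poly {poly {poly K}}}) :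
  ev3 x1 x2 s (2 * p * q + r) = 2 * ev3 x1 x2 s p * ev3 x1 x2 s q + ev3 x1 x2 s r.
Proof. by rewrite ev3D ev3_2M. Qed.

Lemma ev3_quadr x1 x2 s (q b c : {poly {poly K}}) :
  ev3 x1 x2 s (quadr q b c) =
  ev3 x1 x2 s q%:P * x1 ^+ 2 + ev3 x1 x2 s b%:P * x1 + ev3 x1 x2 s c%:P.
Proof.
rewrite /quadr; move: q%:P b%:P c%:P => Q B C.
by rewrite !ev3D ev3M ev3X ev3M ev3x.
Qed.

(** A nonzero polynomial in three variables is nonzero at some point with natural coordinates, found
    one variable at a time. This lifts pointwise hypotheses to polynomial identities. *)
Lemma ev3_inj p q : (forall x1 x2 s, ev3 x1 x2 s p = ev3 x1 x2 s q) -> p = q.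
Proof.
move=> h; apply/eqP; rewrite -subr_eq0; apply/negPn/negP => pq0.
have [l] := poly_nat_nonroot natPP_neq0 pq0; move=> /(poly_nat_nonroot natP_neq0)[m].
move=> /(@poly_nat_nonroot K)[n|n]; first by rewrite pnatr_eq0.
rewrite -!polyC_natr -[_.[_]]/(ev3 _ _ _ (p - q)) ev3D ev3N h subrr.
by rewrite eqxx.
Qed.

(* V and W are the partial derivatives of F in x2 and s.  On the surface F = 0
   one has (F_x1 V)^2 = (2 J W)^2; as F is irreducible in x1 over K(x2, s), one
   sign holds on the whole surface. *)
Lemma uniform_sign P J (q b c : {poly {poly K}})
    (v2 v1 v0 w2 w1 w0 : {poly {poly {poly K}}}) :
  ~ (exists j, J = j ^+ 2) ->
  let F x1 x2 s := ev3 x1 x2 s q%:P * x1 ^+ 2 + ev3 x1 x2 s b%:P * x1 +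
    ev3 x1 x2 s c%:P in
  (forall x1 x2 s, F x1 x2 s = ev3 x1 x2 s v2 * x2 ^+ 2 + ev3 x1 x2 s v1 * x2 +
    ev3 x1 x2 s v0) ->
  (forall x1 x2 s, F x1 x2 s = ev3 x1 x2 s w2 * s ^+ 2 + ev3 x1 x2 s w1 * s +
    ev3 x1 x2 s w0) ->
  (forall x1 x2 s, ev3 x1 x2 s b%:P ^+ 2 -
    4 * ev3 x1 x2 s q%:P * ev3 x1 x2 s c%:P = 4 * P.[x2] * J.[s]) ->
  (forall x1 x2 s, ev3 x1 x2 s v1 ^+ 2 -
    4 * ev3 x1 x2 s v2 * ev3 x1 x2 s v0 = 4 * P.[x1] * J.[s]) ->
  (forall x1 x2 s, ev3 x1 x2 s w1 ^+ 2 -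
    4 * ev3 x1 x2 s w2 * ev3 x1 x2 s w0 = 4 * P.[x1] * P.[x2]) ->
  exists2 delta : K, delta = 1 \/ delta = -1 &
  forall x1 x2 s, F x1 x2 s = 0 -> P.[x2] * J.[s] != 0 ->
    (2 * ev3 x1 x2 s q%:P * x1 + ev3 x1 x2 s b%:P) *
    (2 * ev3 x1 x2 s v2 * x2 + ev3 x1 x2 s v1) =
    delta * (2 * J.[s] * (2 * ev3 x1 x2 s w2 * s + ev3 x1 x2 s w1)).
Proof.
move=> nsJ F0E Fv Fw Db Dv Dw.
have evF x1 x2 s : ev3 x1 x2 s (quadr q b c) = F0E x1 x2 s.
  by rewrite ev3_quadr.
have D : b ^+ 2 - 4 * q * c = 4 * map_poly polyC P * J%:P.
  apply: polyC_inj; apply: ev3_inj => x1 x2 s.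
  rewrite polyCB polyC_exp !polyCM !polyC_natr ev3_discr Db.
  by rewrite ev3_4M (ev3_iny x1 x2 s P) ev3_inz.
pose V : {poly {poly {poly K}}} := 2 * v2 * 'X%:P + v1.
pose W : {poly {poly {poly K}}} := 2 * w2 * 'X%:P%:P + w1.
have eV : V ^+ 2 = 4 * inx P * J%:P%:P + 4 * v2 * quadr q b c.
  apply: ev3_inj => x1 x2 s.
  rewrite ev3D !ev3_4M evF Fv ev3_inx ev3_inz -(Dv x1 x2 s) ev3X ev3_lin ev3y.
  move: (ev3 _ _ _ v2) (ev3 _ _ _ v1) (ev3 _ _ _ v0) => A B C; ring.
have eW : W ^+ 2 = 4 * inx P * iny P + 4 * w2 * quadr q b c.
  apply: ev3_inj => x1 x2 s.
  rewrite ev3D !ev3_4M evF Fw ev3_inx ev3_iny -(Dw x1 x2 s) ev3X ev3_lin ev3z.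
  move: (ev3 _ _ _ w2) (ev3 _ _ _ w1) (ev3 _ _ _ w0) => A B C; ring.
(* For [P = 0] the side condition [P.[x2] * J.[s] != 0] always fails, so either sign will do. *)
have [->|P0] := eqVneq P 0.
  by exists 1; [left|move=> x1 x2 s _; rewrite horner0 mul0r eqxx].
suff [delta d1 H] : exists2 delta : K, delta = 1 \/ delta = -1 &
    forall x1 x2 s, ev3 x1 x2 s (quadr q b c) = 0 -> P.[x2] * J.[s] != 0 ->
    ev3 x1 x2 s ((2%:R * q)%:P * 'X + b%:P) * ev3 x1 x2 s V =
    delta * (2 * J.[s] * ev3 x1 x2 s W).
  exists delta => // x1 x2 s; rewrite -evF => /H /[apply].
  by rewrite polyCM polyC_natr !ev3_lin ev3x ev3y ev3z.
clear F0E Fv Fw Db Dv Dw evF; clearbody V W; set F := quadr q b c in eV eW *.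
set U := (2%:R * q)%:P * 'X + b%:P.
have ns (d g : {poly {poly K}}) : d != 0 -> d ^+ 2 * (b ^+ 2 - 4 * q * c) != g ^+ 2.
  by move=> d0; apply/eqP; rewrite D => /square_factor_bipoly - /(_ d0 P0).
(* With [q = 0] the discriminant would be the square [b ^+ 2]. *)
have q0 : q != 0.
  apply/eqP => q0; have := ns 1 b (oner_neq0 _).
  by rewrite q0 mulr0 mul0r subr0 expr1n mul1r eqxx.
have eU : U ^+ 2 = 4 * iny P * J%:P%:P + 4 * q%:P * F.
  have -> : 4 * iny P * J%:P%:P = (b ^+ 2 - 4 * q * c)%:P.
    by rewrite D !polyCM polyC_natr.
  exact: quadr_deriv_sqr.
have dvd : F %| (U * V - 2 * J%:P%:P * W) * (U * V + 2 * J%:P%:P * W).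
  by rewrite (sign_product eU eV eW) dvdp_mull.
have UF : U = deriv F by rewrite quadr_deriv.
(* Divisibility only gives [d *: T = Q * F], and [d] may vanish at the chosen (x2, s). There P(x2)
   J(s) != 0 forces F_x1 != 0, so F does not become the zero polynomial in x1, and
   [specialize_multiple] removes the bad factors of [d], first for x2 and then for s. *)
have vanish T : F %| T -> forall x1 x2 s, ev3 x1 x2 s F = 0 ->
    P.[x2] * J.[s] != 0 -> ev3 x1 x2 s T = 0.
  move: UF eU; clear dvd; clearbody F U => UF eU.
  move=> /dvdp_idomainP[d d0 [Q e]] x1 x2 s F0 PJ0.
  have U0 : ev3 x1 x2 s U != 0.
    apply: contraNneq PJ0 => U0; move: (congr1 (ev3 x1 x2 s) eU).
    rewrite ev3X U0 expr0n /= ev3D !ev3_4M ev3_iny ev3_inz F0 mulr0 addr0 -mulrA => /esym/eqP.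
    by rewrite mulf_eq0 pnatr_eq0.
  have evmap p : ev3 x1 x2 s p =
      (map_poly (horner_eval s) (map_poly (horner_eval x2%:P) p)).[x1].
    rewrite /ev3 -[in RHS](hornerC x1 s) -[X in _.[X]]/(horner_eval s x1%:P).
    rewrite horner_map -[in RHS](hornerC x1%:P x2%:P).
    by rewrite -[X in _.[X]]/(horner_eval x2%:P x1%:P%:P) horner_map.
  have mF0 : map_poly (horner_eval s) (map_poly (horner_eval x2%:P) F) != 0.
    apply: contraNneq U0 => m0.
    by rewrite UF evmap -!deriv_map m0 linear0 horner0.
  have F10 : map_poly (horner_eval x2%:P) F != 0.
    by apply: contraNneq mF0 => ->; rewrite rmorph0.
  have [d1 d10 [Q1 e1]] := specialize_multiple d0 e F10.
  have [d2 d20 [Q2 e2]] := specialize_multiple d10 e1 mF0.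
  move: (congr1 (horner^~ x1) e2); rewrite /= hornerM hornerZ -!evmap F0 mulr0.
  by move/eqP; rewrite mulf_eq0 (negPf d20) => /eqP.
(* Being prime, F divides one of the two factors, and which one it divides fixes the sign. *)
have [/vanish dv|/vanish dv] := quadr_prime q0 ns dvd; clearbody U.
- exists 1; [by left|move=> x1 x2 s F0 PJ0]; have /eqP := dv _ _ _ F0 PJ0.
  by rewrite ev3D ev3N ev3_2M ev3_inz ev3M subr_eq0 mul1r => /eqP.
- exists (-1); [by right|move=> x1 x2 s F0 PJ0]; have /eqP := dv _ _ _ F0 PJ0.
  by rewrite ev3D ev3_2M ev3_inz ev3M addr_eq0 mulN1r => /eqP.
Qed.

End SignLemma.

(** * Partial derivatives of the triquadratic polynomial *)

Section Triquadratic.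
Variables (R : realType) (a : nat -> nat -> nat -> Cplx R).
Local Notation C := (Cplx R).
Implicit Types (x s : C) (P J : {poly C}).

Definition diff_x1 x1 x2 s : C := 2 * coef_x1 a 2 s x2 * x1 + coef_x1 a 1 s x2.
Definition diff_x2 x1 x2 s : C := 2 * coef_x2 a 2 s x1 * x2 + coef_x2 a 1 s x1.
Definition diff_s x1 x2 s : C := 2 * coef_s a 2 x1 x2 * s + coef_s a 1 x1 x2.

Lemma tri_evalE_x1 x1 x2 s :
  tri_eval a x1 x2 s =
  coef_x1 a 2 s x2 * x1 ^+ 2 + coef_x1 a 1 s x2 * x1 + coef_x1 a 0 s x2.
Proof.
transitivity (\sum_(i < 3) coef_x1 a i s x2 * x1 ^+ i).
  apply: eq_bigr => i _; rewrite mulr_suml; apply: eq_bigr => j _.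
  by rewrite mulr_suml; apply: eq_bigr => l _; ring.
by rewrite !big_ord_recr big_ord0 /=; ring.
Qed.

Lemma tri_evalE_x2 x1 x2 s :
  tri_eval a x1 x2 s =
  coef_x2 a 2 s x1 * x2 ^+ 2 + coef_x2 a 1 s x1 * x2 + coef_x2 a 0 s x1.
Proof.
transitivity (\sum_(j < 3) coef_x2 a j s x1 * x2 ^+ j).
  rewrite /tri_eval exchange_big /=.
  apply: eq_bigr => j _; rewrite mulr_suml; apply: eq_bigr => i _.
  by rewrite mulr_suml; apply: eq_bigr => l _; ring.
by rewrite !big_ord_recr big_ord0 /=; ring.
Qed.

Lemma tri_evalE_s x1 x2 s :
  tri_eval a x1 x2 s =
  coef_s a 2 x1 x2 * s ^+ 2 + coef_s a 1 x1 x2 * s + coef_s a 0 x1 x2.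
Proof.
transitivity (\sum_(l < 3) coef_s a l x1 x2 * s ^+ l).
  rewrite /tri_eval; under eq_bigr do rewrite exchange_big /=.
  rewrite exchange_big /=; apply: eq_bigr => l _.
  rewrite mulr_suml; apply: eq_bigr => i _.
  by rewrite mulr_suml; apply: eq_bigr => j _.
by rewrite !big_ord_recr big_ord0 /=; ring.
Qed.

Section Separable.
Variables P J : {poly C}.
Hypothesis sep : discriminantly_separable a P J.

(** For a quadratic, (2 q x + b)^2 is the discriminant plus 4 q times its value; separability then
    factors the discriminant. On F = 0 only the product remains. *)
Lemma diff_x1_sqr x1 x2 s :
  diff_x1 x1 x2 s ^+ 2 =
  4 * P.[x2] * J.[s] + 4 * coef_x1 a 2 s x2 * tri_eval a x1 x2 s.
Proof.
case: sep => _ /(_ s x2) <- _.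
rewrite /discr tri_evalE_x1 /diff_x1; ring.
Qed.

Lemma diff_x2_sqr x1 x2 s :
  diff_x2 x1 x2 s ^+ 2 =
  4 * P.[x1] * J.[s] + 4 * coef_x2 a 2 s x1 * tri_eval a x1 x2 s.
Proof.
case: sep => _ _ /(_ s x1) <-.
rewrite /discr tri_evalE_x2 /diff_x2; ring.
Qed.

Lemma diff_s_sqr x1 x2 s :
  diff_s x1 x2 s ^+ 2 =
  4 * P.[x1] * P.[x2] + 4 * coef_s a 2 x1 x2 * tri_eval a x1 x2 s.
Proof.
case: sep => /(_ x1 x2) <- _ _.
rewrite /discr tri_evalE_s /diff_s; ring.
Qed.

(** These coefficients live in [{poly {poly C}}], free of x1, so that F becomes a [quadr] over
    K[x2, s]. The coefficients in x2 and in s below involve x1 and need the full ring. *)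
Lemma ev3_coef_x1 : exists cx1 : nat -> {poly {poly C}},
  forall x1 x2 s i, ev3 x1 x2 s (cx1 i)%:P = coef_x1 a i s x2.
Proof.
exists (fun i => \sum_(j < 3) \sum_(l < 3) (a i j l)%:P%:P * 'X ^+ j * 'X%:P ^+ l).
move=> x1 x2 s i; rewrite rmorph_sum /= ev3_sum; apply: eq_bigr => j _.
rewrite rmorph_sum /= ev3_sum; apply: eq_bigr => l _.
by rewrite !polyCM !polyC_exp 2!ev3M !ev3X ev3C ev3y ev3z.
Qed.

Lemma ev3_coef_x2 : exists cx2 : nat -> {poly {poly {poly C}}},
  forall x1 x2 s j, ev3 x1 x2 s (cx2 j) = coef_x2 a j s x1.
Proof.
exists (fun j => \sum_(i < 3) \sum_(l < 3) (a i j l)%:P%:P%:P * 'X ^+ i * 'X%:P%:P ^+ l).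
move=> x1 x2 s j; rewrite ev3_sum; apply: eq_bigr => i _.
rewrite ev3_sum; apply: eq_bigr => l _.
by rewrite 2!ev3M !ev3X ev3C ev3x ev3z.
Qed.

Lemma ev3_coef_s : exists cs : nat -> {poly {poly {poly C}}},
  forall x1 x2 s l, ev3 x1 x2 s (cs l) = coef_s a l x1 x2.
Proof.
exists (fun l => \sum_(i < 3) \sum_(j < 3) (a i j l)%:P%:P%:P * 'X ^+ i * 'X%:P ^+ j).
move=> x1 x2 s l; rewrite ev3_sum; apply: eq_bigr => i _.
rewrite ev3_sum; apply: eq_bigr => j _.
by rewrite 2!ev3M !ev3X ev3C ev3x ev3y.
Qed.

Lemma diff_sign : ~ (exists j : {poly C}, J = j ^+ 2) ->
  exists2 delta : C, delta = 1 \/ delta = -1 &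
  forall x1 x2 s, tri_eval a x1 x2 s = 0 -> P.[x2] * J.[s] != 0 ->
    diff_x1 x1 x2 s * diff_x2 x1 x2 s = delta * (2 * J.[s] * diff_s x1 x2 s).
Proof.
move=> nsJ; have [cx1 e1] := ev3_coef_x1.
have [[cx2 e2] [cs e3]] := (ev3_coef_x2, ev3_coef_s).
case: sep => Ds D1 D2.
have [|||||delta d1 H] := @uniform_sign _ P J (cx1 2%N) (cx1 1%N) (cx1 0%N)
    (cx2 2%N) (cx2 1%N) (cx2 0%N) (cs 2%N) (cs 1%N) (cs 0%N) nsJ.
- by move=> x1 x2 s; rewrite !e1 !e2 -tri_evalE_x1 tri_evalE_x2.
- by move=> x1 x2 s; rewrite !e1 !e3 -tri_evalE_x1 tri_evalE_s.
- by move=> x1 x2 s; rewrite !e1; exact: D1.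
- by move=> x1 x2 s; rewrite !e2; exact: D2.
- by move=> x1 x2 s; rewrite !e3; exact: Ds.
exists delta => // x1 x2 s F0 PJ0.
have := H x1 x2 s; rewrite !e1 !e2 !e3; apply=> //.
by rewrite -tri_evalE_x1.
Qed.

End Separable.
End Triquadratic.

(** * Complex derivatives of square roots and monomials *)

Section ComplexDerivatives.
Variable K : numFieldType.
Implicit Types (f g w x y z : K -> K) (t : K).

(** The difference quotient of [w] is that of [f] divided by w(t + h) + w(t), which tends to 2 w(t)
    != 0 by continuity. *)
Lemma derivable_sqrt w f t : {for t, continuous w} ->
  (\forall u \near t, w u ^+ 2 = f u) -> derivable f t 1 -> w t != 0 ->
  derivable w t 1.
Proof.
move=> cw wf df wt0.
have shift_cvg : h + t @[h --> (0 : K)^'] --> t.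
  apply: cvg_within_filter; have : h + t @[h --> (0 : K)] --> 0 + t.
    exact: (cvgD (f := id) cvg_id (cvg_cst t)).
  by rewrite add0r.
have cwh : w (h + t) @[h --> (0 : K)^'] --> w t by apply: cvg_comp shift_cvg cw.
have sum_neq0 : w t + w t != 0 by rewrite -mulr2n mulrn_eq0.
have cs : w (h + t) + w t @[h --> (0 : K)^'] --> w t + w t.
  by apply: cvgD cwh _; exact: cvg_cst.
apply/cvg_ex; exists ('D_1 f t / (w t + w t)).
apply: cvg_trans (cvgM df (cvgV sum_neq0 cs)); apply: near_eq_cvg.
near=> h.
have e1 : w (h + t) ^+ 2 = f (h + t).
  by near: h; exact: (shift_cvg _ wf).
have e2 : w t ^+ 2 = f t by exact: nbhs_singleton wf.
have e3 : w (h + t) + w t != 0 by near: h; exact: cvgr_neq0 cs sum_neq0.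
rewrite /= [h%:A]mulr1 -e1 -e2 subr_sqr [_ *: _]/(_ * _).
by rewrite -!mulrA divff // mulr1.
Unshelve. all: by end_near. Qed.

Lemma derivable_bipoly (c : nat -> nat -> K) x y t :
  derivable x t 1 -> derivable y t 1 ->
  derivable (fun u => \sum_(i < 3) \sum_(j < 3) c i j * x u ^+ i * y u ^+ j) t 1.
Proof.
move=> dx dy.
rewrite (_ : (fun u => _) =
    \sum_(i < 3) \sum_(j < 3) cst (c i j) * x ^+ i * y ^+ j); last first.
  apply/funext => u; rewrite fct_sumE; apply: eq_bigr => i _.
  by rewrite fct_sumE; apply: eq_bigr => j _; rewrite !exprfctE.
apply: derivable_sum => i; apply: derivable_sum => j.
by apply: derivableM; [apply: derivableM; [exact: derivable_cst|]|]; exact: derivableX.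
Qed.

(** At exponent 0 the truncated predecessor [i.-1] is harmless, since the factor [i%:R] is 0. *)
Lemma is_derive_monomial (c : K) i j l x y z t (dx dy dz : K) :
  is_derive t 1 x dx -> is_derive t 1 y dy -> is_derive t 1 z dz ->
  is_derive t 1 (fun u => c * x u ^+ i * y u ^+ j * z u ^+ l)
    (c * (i%:R * x t ^+ i.-1) * y t ^+ j * z t ^+ l * dx +
     c * x t ^+ i * (j%:R * y t ^+ j.-1) * z t ^+ l * dy +
     c * x t ^+ i * y t ^+ j * (l%:R * z t ^+ l.-1) * dz).
Proof.
move=> hx hy hz.
rewrite (_ : (fun u => _) = cst c * x ^+ i * y ^+ j * z ^+ l); last first.
  by apply/funext => u; rewrite !exprfctE.
apply: is_derive_eq; rewrite !exprfctE /= scaler0 addr0.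
rewrite !mulrfctE /GRing.scale /=; ring.
Qed.

Lemma derivable1_continuous f t : derivable f t 1 -> {for t, continuous f}.
Proof. by move=> /derivable1_diffP/differentiable_continuous. Qed.

End ComplexDerivatives.

(** * Differentiating the roots of F(x1, x2, s) = 0 along the flow *)

Section ImplicitRoot.
Variables (R : realType) (a : nat -> nat -> nat -> Cplx R).
Local Notation C := (Cplx R).
Implicit Types (x y s : C -> C) (t : C).

(** The chain rule is applied monomial by monomial; each triple sum is then regrouped with the
    differentiated variable outermost. *)
Lemma is_derive_tri_eval x y s t (dx dy ds : C) :
  is_derive t 1 x dx -> is_derive t 1 y dy -> is_derive t 1 s ds ->
  is_derive t 1 (fun u => tri_eval a (x u) (y u) (s u))
    (diff_x1 a (x t) (y t) (s t) * dx + diff_x2 a (x t) (y t) (s t) * dy +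
     diff_s a (x t) (y t) (s t) * ds).
Proof.
move=> hx hy hs.
rewrite (_ : (fun u => _) = \sum_(i < 3) \sum_(j < 3) \sum_(l < 3)
    (fun u => a i j l * x u ^+ i * y u ^+ j * s u ^+ l)); last first.
  apply/funext => u; rewrite fct_sumE; apply: eq_bigr => i _.
  by rewrite fct_sumE; apply: eq_bigr => j _; rewrite fct_sumE.
apply: is_derive_eq.
  apply: is_derive_sum => i; apply: is_derive_sum => j; apply: is_derive_sum => l.
  exact: is_derive_monomial hx hy hs.
have -> : diff_x1 a (x t) (y t) (s t) * dx = \sum_(i < 3) \sum_(j < 3) \sum_(l < 3)
    a i j l * (i%:R * x t ^+ i.-1) * y t ^+ j * s t ^+ l * dx.
  transitivity (\sum_(i < 3) coef_x1 a i (s t) (y t) * (i%:R * x t ^+ i.-1) * dx).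
    by rewrite !big_ord_recr big_ord0 /= /diff_x1; ring.
  apply: eq_bigr => i _; rewrite !mulr_suml; apply: eq_bigr => j _.
  by rewrite !mulr_suml; apply: eq_bigr => l _; ring.
have -> : diff_x2 a (x t) (y t) (s t) * dy = \sum_(i < 3) \sum_(j < 3) \sum_(l < 3)
    a i j l * x t ^+ i * (j%:R * y t ^+ j.-1) * s t ^+ l * dy.
  transitivity (\sum_(j < 3) coef_x2 a j (s t) (x t) * (j%:R * y t ^+ j.-1) * dy).
    by rewrite !big_ord_recr big_ord0 /= /diff_x2; ring.
  rewrite [RHS]exchange_big; apply: eq_bigr => j _.
  rewrite !mulr_suml; apply: eq_bigr => i _.
  by rewrite !mulr_suml; apply: eq_bigr => l _; ring.
have -> : diff_s a (x t) (y t) (s t) * ds = \sum_(i < 3) \sum_(j < 3) \sum_(l < 3)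
    a i j l * x t ^+ i * y t ^+ j * (l%:R * s t ^+ l.-1) * ds.
  transitivity (\sum_(l < 3) coef_s a l (x t) (y t) * (l%:R * s t ^+ l.-1) * ds).
    by rewrite !big_ord_recr big_ord0 /= /diff_s; ring.
  under [RHS]eq_bigr do rewrite exchange_big /=.
  rewrite [RHS]exchange_big; apply: eq_bigr => l _.
  rewrite !mulr_suml; apply: eq_bigr => i _.
  by rewrite !mulr_suml; apply: eq_bigr => j _; ring.
rewrite -!big_split; apply: eq_bigr => i _ /=.
rewrite -!big_split; apply: eq_bigr => j _ /=.
by rewrite -!big_split.
Qed.

Lemma derivable_coef_s l x y t : derivable x t 1 -> derivable y t 1 ->
  derivable (fun u => coef_s a l (x u) (y u)) t 1.
Proof. by move=> dx dy; exact: (derivable_bipoly (c := fun i j => a i j l) dx dy). Qed.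

Lemma derivable_coef_x1 i s y t : derivable y t 1 -> derivable s t 1 ->
  derivable (fun u => coef_x1 a i (s u) (y u)) t 1.
Proof. by move=> dx dy; exact: (derivable_bipoly (c := fun j l => a i j l) dx dy). Qed.

Lemma derivable_coef_x2 j s x t : derivable x t 1 -> derivable s t 1 ->
  derivable (fun u => coef_x2 a j (s u) (x u)) t 1.
Proof. by move=> dx dy; exact: (derivable_bipoly (c := fun i l => a i j l) dx dy). Qed.

(** Vieta's formulas: subtract the two equations and cancel [z - z']. *)
Lemma quadratic_roots (A B D z z' : C) : z != z' ->
  A * z ^+ 2 + B * z + D = 0 -> A * z' ^+ 2 + B * z' + D = 0 ->
  B = - (A * (z + z')) /\ D = A * z * z'.
Proof.
move=> zz' r1 r2.
have eB : B = - (A * (z + z')).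
  have : z - z' != 0 by rewrite subr_eq0.
  move=> /mulIf; apply; apply/eqP; rewrite -subr_eq0; apply/eqP.
  transitivity ((A * z ^+ 2 + B * z + D) - (A * z' ^+ 2 + B * z' + D)); first by ring.
  by rewrite r1 r2 subrr.
split=> //; move: r1; rewrite eB => /eqP; rewrite addrC addr_eq0 => /eqP ->; ring.
Qed.

Section Roots.
Variables (Ph : {poly C}) (U : set C) (x y s s' : C -> C) (t : C).
Hypotheses (Uo : open U) (Ut : U t).
Hypothesis roots : separation_roots a Ph U x y s s'.
Hypotheses (dx : derivable x t 1) (dy : derivable y t 1).

Let Unear : \forall u \near t, U u.
Proof. exact: open_nbhs_nbhs. Qed.

(** A continuous square root of the discriminant B^2 - 4 A C. *)
Let w u := coef_s a 2 (x u) (y u) * (s u - s' u).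

Lemma root_sum u : U u -> coef_s a 1 (x u) (y u) =
  - (coef_s a 2 (x u) (y u) * (s u + s' u)).
Proof.
move=> Uu; have [//] := quadratic_roots (sr_neq roots Uu)
  (etrans (esym (tri_evalE_s _ _ _ _)) (sr_root1 roots Uu))
  (etrans (esym (tri_evalE_s _ _ _ _)) (sr_root2 roots Uu)).
Qed.

Lemma root_prod u : U u -> coef_s a 0 (x u) (y u) =
  coef_s a 2 (x u) (y u) * s u * s' u.
Proof.
move=> Uu; have [//] := quadratic_roots (sr_neq roots Uu)
  (etrans (esym (tri_evalE_s _ _ _ _)) (sr_root1 roots Uu))
  (etrans (esym (tri_evalE_s _ _ _ _)) (sr_root2 roots Uu)).
Qed.

(** The roots are only assumed continuous. But [w] is a nonvanishing continuous square root of a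
    differentiable function, hence differentiable, and s = (w - B) / (2 A) near [t]. *)
Lemma derivable_root : derivable s t 1.
Proof.
have dA := derivable_coef_s (l := 2%N) dx dy.
have dB := derivable_coef_s (l := 1%N) dx dy.
have dC := derivable_coef_s (l := 0%N) dx dy.
have inUt : t \in U by rewrite inE.
have dw : derivable w t 1.
  apply: (@derivable_sqrt _ w (fun u => coef_s a 1 (x u) (y u) ^+ 2
     - 4 * coef_s a 2 (x u) (y u) * coef_s a 0 (x u) (y u))).
  - have cA := derivable1_continuous dA.
    exact: (continuousM cA (continuousB (sr_s1_cont roots inUt) (sr_s2_cont roots inUt))).
  - near=> u; have Uu : U u by near: u.
    by rewrite (root_sum Uu) (root_prod Uu) /w; ring.
  - rewrite (_ : (fun u => _) = (fun u => coef_s a 1 (x u) (y u)) ^+ 2 -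
      cst 4 * (fun u => coef_s a 2 (x u) (y u)) * (fun u => coef_s a 0 (x u) (y u)));
      last by apply/funext => u; rewrite exprfctE.
    exact: (derivableB (derivableX (n := 2) dB)
      (derivableM (derivableM (derivable_cst (4 : C) t 1) dA) dC)).
  - by rewrite mulf_neq0 ?(sr_lead roots Ut) // subr_eq0 (sr_neq roots Ut).
pose A2 : C -> C := fun u => 2 * coef_s a 2 (x u) (y u).
have A20 : A2 t != 0 by rewrite mulf_neq0 ?pnatr_eq0 ?(sr_lead roots Ut).
have d2A : derivable A2 t 1 := derivableM (derivable_cst (2 : C) t 1) dA.
have dV := derivableV A20 d2A.
have dwB := derivableB dw dB.
have dd := derivableM dV dwB.
apply: near_eq_derivable dd; near=> u; have Uu : U u by near: u.
have A0 := sr_lead roots Uu.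
rewrite mulrfctE addrfctE opprfctE /= /A2 (root_sum Uu) /w; field; exact: A0.
Unshelve. all: by end_near. Qed.

End Roots.

Lemma root_derivative (U : set C) x y s t : open U -> U t ->
  (forall u, U u -> tri_eval a (x u) (y u) (s u) = 0) ->
  derivable x t 1 -> derivable y t 1 -> derivable s t 1 ->
  diff_x1 a (x t) (y t) (s t) * derive1 x t +
  diff_x2 a (x t) (y t) (s t) * derive1 y t +
  diff_s a (x t) (y t) (s t) * derive1 s t = 0.
Proof.
move=> Uo Ut F0 dx dy ds; rewrite !derive1E.
have [_ <-] := is_derive_tri_eval (derivableP dx) (derivableP dy) (derivableP ds).
transitivity ('D_1 (cst (0 : C)) t); last by rewrite derive_cst.
apply: near_eq_derive; near=> u; rewrite F0 //.
by near: u; exact: open_nbhs_nbhs.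
Unshelve. all: by end_near. Qed.

End ImplicitRoot.

(** In the expanded square, u^2 f1^2 + v^2 f2^2 reduces to 2 J (B^2 - 4 A D) + 4 J A (D - k^2 A).
    The sign [d] enters the cross term twice and cancels; Vieta finishes the computation. With
    opposite signs in [u * v] and [f1 * f2] the result would contain s'^2 instead of s^2, so the two
    signs must agree. *)
Lemma kotter_identity (K : numFieldType) (p1 p2 A B D e1 e2 f1 f2 u v J s s' k d : K) :
  f1 ^+ 2 = p1 + e1 * A -> f2 ^+ 2 = p2 + e2 * A ->
  p2 * e1 + p1 * e2 = D - e1 * e2 * A -> e1 * e2 = k ^+ 2 ->
  B ^+ 2 - 4 * A * D = 4 * p1 * p2 ->
  B = - (A * (s + s')) -> D = A * s * s' ->
  u ^+ 2 = 4 * p2 * J -> v ^+ 2 = 4 * p1 * J ->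
  u * v = d * (2 * J * (A * (s - s'))) -> f1 * f2 = d * (B / 2) -> d ^+ 2 = 1 ->
  (u * f1 - v * f2) ^+ 2 = (2 * A) ^+ 2 * (J * (s ^+ 2 - k ^+ 2)).
Proof.
move=> hf1 hf2 rel hk disc hB hD hu hv huv hf hd.
transitivity (u ^+ 2 * f1 ^+ 2 + v ^+ 2 * f2 ^+ 2 - 2 * (u * v) * (f1 * f2)).
  by ring.
rewrite hu hv hf1 hf2 huv hf.
transitivity (2 * J * (4 * p1 * p2) + 4 * J * A * (p2 * e1 + p1 * e2)
   - 2 * d ^+ 2 * J * A * (s - s') * B); first by field.
by rewrite -disc rel hk hd hB hD; ring.
Qed.

Lemma separation_roots_sym (R : realType) (a : nat -> nat -> nat -> Cplx R)
    (Ph : {poly Cplx R}) (U : set (Cplx R)) (x1 x2 s s' : Cplx R -> Cplx R) :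
  separation_roots a Ph U x1 x2 s s' -> separation_roots a Ph U x1 x2 s' s.
Proof. by case=> *; split=> // t Ut; rewrite eq_sym; auto. Qed.

(** * Linearization of the reduced system *)

Section Linearization.
Variables (R : realType) (a : nat -> nat -> nat -> Cplx R) (P J : {poly Cplx R}).
Local Notation C := (Cplx R).
Hypothesis sep : discriminantly_separable a P J.
Variable delta : C.
Hypothesis delta2 : delta ^+ 2 = 1.
Hypothesis sign : forall x1 x2 s : C, tri_eval a x1 x2 s = 0 ->
  P.[x2] * J.[s] != 0 ->
  diff_x1 a x1 x2 s * diff_x2 a x1 x2 s = delta * (2 * J.[s] * diff_s a x1 x2 s).
Variables (m : C -> C -> C -> C -> C -> C -> C) (U : set C)
  (x1 x2 e1 e2 r gamma3 f1 f2 : C -> C) (k : C).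
Hypothesis Uo : open U.
Hypothesis sol : reduced_solution a P m U x1 x2 e1 e2 r gamma3 f1 f2.
Hypothesis ek : forall t, U t -> e1 t * e2 t = k ^+ 2.

(** Expanding the product of the two squares, the invariant relation cancels the term e1 e2 A^2 and
    leaves P(x1) P(x2) + A C = B^2 / 4. *)
Lemma prod_f_sqr t : U t ->
  (f1 t * f2 t) ^+ 2 = (coef_s a 1 (x1 t) (x2 t) / 2) ^+ 2.
Proof.
move=> Ut; have [/(_ (x1 t) (x2 t)) disc _ _] := sep.
rewrite exprMn (rs_f1 sol Ut) (rs_f2 sol Ut).
transitivity (P.[x1 t] * P.[x2 t] +
  coef_s a 2 (x1 t) (x2 t) * (P.[x2 t] * e1 t + P.[x1 t] * e2 t) +
  e1 t * e2 t * coef_s a 2 (x1 t) (x2 t) ^+ 2); first by ring.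
rewrite (rs_relation sol Ut).
transitivity (4 * P.[x1 t] * P.[x2 t] / 4 +
  coef_s a 2 (x1 t) (x2 t) * coef_s a 0 (x1 t) (x2 t)); first by field.
by rewrite -disc /discr; field.
Qed.

Hypothesis ff : forall t, U t ->
  f1 t * f2 t = delta * (coef_s a 1 (x1 t) (x2 t) / 2).

(** Up to the factor -i A, this is the derivative of F along the flow with s held fixed. *)
Definition branch s (t : C) : C :=
  (diff_x1 a (x1 t) (x2 t) (s t) * f1 t - diff_x2 a (x1 t) (x2 t) (s t) * f2 t) /
  (2 * coef_s a 2 (x1 t) (x2 t)).

Section Root.
Variables s s' : C -> C.
Hypothesis roots : separation_roots a (Phi J k) U x1 x2 s s'.

Lemma diff_s_root t : U t -> diff_s a (x1 t) (x2 t) (s t) =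
  coef_s a 2 (x1 t) (x2 t) * (s t - s' t).
Proof. by move=> Ut; rewrite /diff_s (root_sum roots Ut); ring. Qed.

Lemma branch_sqr t : U t -> branch s t ^+ 2 = (Phi J k).[s t].
Proof.
move=> Ut; have A0 := sr_lead roots Ut; have F0 := sr_root1 roots Ut.
have [/(_ (x1 t) (x2 t)) disc _ _] := sep.
have PhiE : (Phi J k).[s t] = J.[s t] * (s t ^+ 2 - k ^+ 2).
  by rewrite /Phi !hornerM hornerXsubC hornerD hornerX hornerC; ring.
have J0 : J.[s t] != 0.
  by apply: contraNneq (sr_Phi1 roots Ut) => J0; rewrite PhiE J0 mul0r.
(* Distinct roots give F_s != 0, while F_s^2 = 4 P(x1) P(x2) on the surface; this makes the sign
   relation available. *)
have P20 : P.[x2 t] != 0.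
  have := diff_s_sqr sep (x1 t) (x2 t) (s t).
  rewrite F0 mulr0 addr0 (diff_s_root Ut) => e.
  apply: contraNneq (sr_neq roots Ut) => P0; move/eqP: e.
  by rewrite P0 mulr0 sqrf_eq0 mulf_eq0 (negPf A0) subr_eq0.
have hu : diff_x1 a (x1 t) (x2 t) (s t) ^+ 2 = 4 * P.[x2 t] * J.[s t].
  by rewrite (diff_x1_sqr sep) F0 mulr0 addr0.
have hv : diff_x2 a (x1 t) (x2 t) (s t) ^+ 2 = 4 * P.[x1 t] * J.[s t].
  by rewrite (diff_x2_sqr sep) F0 mulr0 addr0.
have := sign F0 (mulf_neq0 P20 J0); rewrite (diff_s_root Ut) => huv.
rewrite /branch expr_div_n (kotter_identity (rs_f1 sol Ut) (rs_f2 sol Ut)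
  (rs_relation sol Ut) (ek Ut) disc (root_sum roots Ut) (root_prod roots Ut)
  hu hv huv (ff Ut) delta2) PhiE mulrC mulKf //.
by rewrite expf_neq0 // mulf_neq0 ?pnatr_eq0.
Qed.

Lemma branch_neq0 t : U t -> branch s t != 0.
Proof.
move=> Ut; apply: contraNneq (sr_Phi1 roots Ut) => b0.
by rewrite -(branch_sqr Ut) b0 expr0n.
Qed.

Lemma derivable_s t : U t -> derivable s t 1.
Proof.
move=> Ut; exact: (derivable_root Uo Ut roots (rs_x1 sol Ut).1 (rs_x2 sol Ut).1).
Qed.

(** Differentiating F = 0 gives A (s - s') ds/dt = i A y, where y is [branch s]. *)
Lemma derive_s t : U t -> derive1 s t = 'i * branch s t / (s t - s' t).
Proof.
move=> Ut; have [dx1 hx1] := rs_x1 sol Ut; have [dx2 hx2] := rs_x2 sol Ut.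
have A0 := sr_lead roots Ut.
have ss0 : s t - s' t != 0 by rewrite subr_eq0 (sr_neq roots Ut).
have := root_derivative Uo Ut (sr_root1 roots) dx1 dx2 (derivable_s Ut).
rewrite (diff_s_root Ut) /branch.
have -> : derive1 x1 t = - 'i * f1 t / 2 by rewrite -hx1 mulrC mulKf // pnatr_eq0.
have -> : derive1 x2 t = 'i * f2 t / 2 by rewrite -hx2 mulrC mulKf // pnatr_eq0.
move: (diff_x1 _ _ _ _) (diff_x2 _ _ _ _) (derive1 s t) (coef_s _ _ _ _) A0.
move=> u v ds A A0 e; apply: (mulfI (mulf_neq0 A0 ss0)).
move/eqP: e; rewrite addrC addr_eq0 => /eqP ->.
by field; rewrite ss0 A0.
Qed.

Lemma branch_continuous : {in U, continuous (branch s)}.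
Proof.
move=> t tU; have Ut : U t by rewrite inE in tU.
have dx1 := (rs_x1 sol Ut).1; have dx2 := (rs_x2 sol Ut).1.
have ds := derivable_s Ut; have A0 := sr_lead roots Ut.
pose A2 : C -> C := fun u => 2 * coef_s a 2 (x1 u) (x2 u).
have dA2 : derivable A2 t 1 :=
  derivableM (derivable_cst (2 : C) t 1) (derivable_coef_s (a := a) (l := 2%N) dx1 dx2).
have A20 : A2 t != 0 by rewrite mulf_neq0 ?pnatr_eq0.
pose c1 : C -> C := fun u => 2 * coef_x1 a 2 (s u) (x2 u).
have dc1 : derivable c1 t 1 :=
  derivableM (derivable_cst (2 : C) t 1) (derivable_coef_x1 (a := a) (i := 2%N) dx2 ds).
have du := derivableD (derivableM dc1 dx1) (derivable_coef_x1 (a := a) (i := 1%N) dx2 ds).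
pose c2 : C -> C := fun u => 2 * coef_x2 a 2 (s u) (x1 u).
have dc2 : derivable c2 t 1 :=
  derivableM (derivable_cst (2 : C) t 1) (derivable_coef_x2 (a := a) (j := 2%N) dx1 ds).
have dv := derivableD (derivableM dc2 dx2) (derivable_coef_x2 (a := a) (j := 1%N) dx1 ds).
have cu := derivable1_continuous du.
have cv := derivable1_continuous dv.
have ci := derivable1_continuous (derivableV A20 dA2).
exact: (continuousM (continuousB (continuousM cu (rs_f1_cont sol tU))
  (continuousM cv (rs_f2_cont sol tU))) ci).
Qed.

End Root.

(** Exchanging the roots yields the second derivative formula. The first sum is i / (s1 - s2) + i /
    (s2 - s1) = 0, the second is i (s1 - s2) / (s1 - s2) = i. *)
Lemma linearized s1 s2 : separation_roots a (Phi J k) U x1 x2 s1 s2 ->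
  linearized_on_jacobian (Phi J k) U s1 s2 0 'i.
Proof.
move=> roots; have roots' := separation_roots_sym roots.
exists (branch s1), (branch s2); split.
- exact: branch_continuous roots.
- exact: branch_continuous roots'.
move=> t Ut; have s12 : s1 t - s2 t != 0 by rewrite subr_eq0 (sr_neq roots Ut).
have s21 : s2 t - s1 t != 0 by rewrite subr_eq0 (sr_neq roots' Ut).
have b1 := branch_neq0 roots Ut; have b2 := branch_neq0 roots' Ut.
split.
- by split; [exact: (derivable_s roots Ut)|exact: (derivable_s roots' Ut)].
- by split; [exact: (branch_sqr roots Ut)|exact: (branch_sqr roots' Ut)].
- rewrite (derive_s roots Ut) (derive_s roots' Ut).
  move: (branch _ _) (branch _ _) b1 b2 => y1 y2 b1 b2.
  by field; rewrite s12 s21 b1 b2.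
- rewrite (derive_s roots Ut) (derive_s roots' Ut).
  move: (branch _ _) (branch _ _) b1 b2 => y1 y2 b1 b2.
  by field; rewrite s12 s21 b1 b2.
Qed.

End Linearization.

(** The sign [eps] and the constants are chosen before the solution, from the polynomial data alone.
    The product f1 f2 is determined up to sign by its square; linearization is claimed for the
    branches whose sign is [eps]. *)
Theorem theorem1 (R : realType) (a : nat -> nat -> nat -> Cplx R)
    (P J : {poly Cplx R}) :
  degree_two_in_each a ->
  discriminantly_separable a P J ->
  ~ (exists j : {poly Cplx R}, J = j ^+ 2) ->
  exists eps c0 c1 : Cplx R,
    [/\ eps = 1 \/ eps = -1,
        ~ (c0 = 0 /\ c1 = 0) &
    forall (m : Cplx R -> Cplx R -> Cplx R -> Cplx R -> Cplx R -> Cplx R ->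
                Cplx R)
      (U : set (Cplx R)) (x1 x2 e1 e2 r gamma3 f1 f2 : Cplx R -> Cplx R)
      (k : Cplx R),
      open U ->
      reduced_solution a P m U x1 x2 e1 e2 r gamma3 f1 f2 ->
      (forall t, U t -> e1 t * e2 t = k ^+ 2) ->
      (forall t, U t ->
         f1 t * f2 t = eps * (coef_s a 1 (x1 t) (x2 t) / 2) \/
         f1 t * f2 t = - eps * (coef_s a 1 (x1 t) (x2 t) / 2)) /\
      ((forall t, U t ->
         f1 t * f2 t = eps * (coef_s a 1 (x1 t) (x2 t) / 2)) ->
       forall s1 s2 : Cplx R -> Cplx R,
         separation_roots a (Phi J k) U x1 x2 s1 s2 ->
         linearized_on_jacobian (Phi J k) U s1 s2 c0 c1)].
Proof.
move=> _ sep nsJ; have [delta d1 sign] := diff_sign sep nsJ.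
have delta2 : delta ^+ 2 = 1 by case: d1 => ->; rewrite ?sqrrN expr1n.
exists delta, 0, 'i; split=> //.
  by case=> _ /eqP; rewrite (negPf (neq0Ci _)).
move=> m U x1 x2 e1 e2 r gamma3 f1 f2 k Uo sol ek; split.
  move=> t Ut; move: (prod_f_sqr sep sol Ut).
  (* Inserting [delta ^+ 2 = 1] makes both sides squares, leaving exactly the two signs. *)
  rewrite -[RHS]mul1r -delta2 -exprMn => /eqP.
  by rewrite eqf_sqr mulNr => /orP[/eqP|/eqP]; [left|right].
move=> ff s1 s2; exact: (linearized sep delta2 sign Uo sol ek ff).
Qed.
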